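(* $r(K_4^{(3)} \setminus e, K_n^{(3)}) = n^{\Theta(n)}$. That is, there are absolute constants $c, C>0$ such that for all sufficiently large $n$, $n^{cn} \le r(K_4^{(3)} \setminus e, K_n^{(3)}) \le n^{Cn}$. Equivalently, the minimum possible independence number of a $3$-graph on $N$ vertices in which any four vertices span at most two edges is $\Theta(\log N/\log\log N)$.
   Context: A $3$-graph is a $3$-uniform hypergraph. For $3$-graphs $H_1,H_2$, the Ramsey number $r(H_1,H_2)$ is the smallest $N$ such that every $3$-graph $\Gamma$ on $N$ vertices contains a copy of $H_1$ (as a subgraph) or its complement $\overline{\Gamma}$ contains a copy of $H_2$. $K_n^{(3)}$ is the complete $3$-graph on $n$ vertices, and $K_4^{(3)}\setminus e$ is the $3$-graph on $4$ vertices with $3$ edges. *)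

(* Defs.v *)
From HB Require Import structures.
From mathcomp Require Import all_boot all_order all_algebra.
From mathcomp Require Import reals exp.

Set Implicit Arguments.
Unset Strict Implicit.
Unset Printing Implicit Defensive.

Record three_graph (T : finType) := ThreeGraph {
  edges :> {set {set T}};
  edges_uniform : [forall e in edges, #|e| == 3]
}.

HB.instance Definition _ (T : finType) := [isSub for @edges T].
HB.instance Definition _ (T : finType) := [Finite of three_graph T by <:].

Section ThreeGraphs.
Variable T : finType.

Definition triples : {set {set T}} := [set e : {set T} | #|e| == 3].

Lemma triplesI_uniform (A : {set {set T}}) :
  [forall e in triples :&: A, #|e| == 3].
Proof. by apply/'forall_implyP => e; rewrite !inE => /andP[]. Qed.

(* three_graph_of A keeps only the 3-element members of A. *)
Definition three_graph_of (A : {set {set T}}) : three_graph T :=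
  ThreeGraph (triplesI_uniform A).

Definition empty3 : three_graph T := three_graph_of set0.

Definition complete3 : three_graph T := three_graph_of setT.

Definition compl3 (G : three_graph T) : three_graph T :=
  three_graph_of (~: edges G).

Definition independent3 (G : three_graph T) (S : {set T}) : bool :=
  [forall e in edges G, ~~ (e \subset S)].

Definition independence_number (G : three_graph T) : nat :=
  \max_(S : {set T} | independent3 G S) #|S|.

Definition four_span_le2 (G : three_graph T) : bool :=
  [forall S : {set T}, (#|S| == 4) ==>
    (#|[set e in edges G | e \subset S]| <= 2)].

End ThreeGraphs.

(* H is a (not necessarily induced) subgraph of G. *)
Definition contains_copy (U T : finType)
    (G : three_graph T) (H : three_graph U) : Prop :=
  exists f : U -> T, injective f /\ forall e, e \in edges H -> f @: e \in edges G.

Definition K3 (n : nat) : three_graph 'I_n := complete3 'I_n.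

Definition K4_minus_e : three_graph 'I_4 :=
  three_graph_of (~: [set [set~ (ord_max : 'I_4)]]).

Definition ramsey_property (U1 U2 : finType)
    (H1 : three_graph U1) (H2 : three_graph U2) (N : nat) : Prop :=
  forall G : three_graph 'I_N, contains_copy G H1 \/ contains_copy (compl3 G) H2.

Definition is_ramsey_number (U1 U2 : finType)
    (H1 : three_graph U1) (H2 : three_graph U2) (r : nat) : Prop :=
  ramsey_property H1 H2 r /\ forall N, ramsey_property H1 H2 N -> r <= N.

(* The default candidate of the arg min, the empty 3-graph, always satisfies
   the constraint, so this is a genuine minimum for every N. *)
Definition min_independence_number (N : nat) : nat :=
  independence_number
    [arg min_(G < empty3 'I_N | four_span_le2 G) independence_number G].

(* Main.v *)
Require Import Defs.
From HB Require Import structures.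
From mathcomp Require Import all_boot all_order all_algebra.
From mathcomp Require Import boolp reals sequences exp.
From mathcomp Require Import ring lra zify.

(* A 3-graph has at most two edges on any four vertices exactly when all its
   links are triangle-free.

   Finding independent sets: grow an independent set A inside a shrinking set X
   of candidates.  If some v in X has degree at least |X| / 4n in the link of
   some a in A, shrink X to that neighbourhood: the link of a then has no edge
   inside X, so this happens at most once for each a.  Otherwise any v in X can
   be added to A at the cost of half of X.  Hence N >= (4n)^(2n) suffices.

   Construction: give each ordered pair (u, v) of vertices d random bits
   w(u, v, i), with 8^d about n, and call {a, b, c} aligned at i if each of the
   three vertices sees the other two with different i-th bits.  The edges are
   the triples aligned at more than 2d/3 of the i's.  If x, y, z spanned a
   triangle in the link of a, some i would make w(a, x, i), w(a, y, i) and
   w(a, z, i) pairwise distinct bits.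

   An n-set is independent with probability at most exp(- const * d n^2), which
   beats the union bound over N^n sets for N = n^(cn).  By the blow-up property
   of the cube it suffices that with probability at least 8^-d / 8 the random
   bits on the n-set are at Hamming distance at least const * d n^2 from every
   independent configuration.  Each triple aligned at all i's must have at
   least d/3 of its bits changed, there are about 8^-d n^3 such triples, and a
   second moment bound on their codegrees shows that no small set of bits can
   meet that many of them. *)

Set Implicit Arguments.
Unset Strict Implicit.
Unset Printing Implicit Defensive.
Import Order.TTheory GRing.Theory Num.Theory.

(** * Link-triangle-free 3-graphs *)

Lemma card_set3 (T : finType) (a b c : T) : #|[set a; b; c]| = size (undup [:: a; b; c]).
Proof.
rewrite -(card_uniqP (undup_uniq _)); apply: eq_card => t.
by rewrite mem_undup !inE orbA.
Qed.

Lemma card_set3_uniq (T : finType) (a b c : T) : (#|[set a; b; c]| == 3) = uniq [:: a; b; c].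
Proof.
rewrite card_set3; apply/eqP/idP => [h|]; last by move/undup_id ->.
by apply: contraT => /negPf nu; have := ltn_size_undup [:: a; b; c]; rewrite h nu.
Qed.

Lemma set3_of_mem (T : finType) (e : {set T}) v : #|e| = 3 -> v \in e ->
  exists b c, [/\ e = [set b; c; v], b \in e & c \in e].
Proof.
move=> e3 ve; have /cards2P[b [c [bc eq_bc]]] : #|e :\ v| == 2.
  by have := cardsD1 v e; rewrite ve e3; lia.
have mem_e x : (x \in e) = [|| x == b, x == c | x == v].
  rewrite -(setD1K ve) eq_bc !inE.
  by case: (x == v); case: (x == b); case: (x == c).
exists b, c; rewrite !mem_e !eqxx orbT; split=> //.
by apply/setP => x; rewrite mem_e !inE orbA.
Qed.

Section ThreeGraphFacts.
Variables (T : finType) (G : three_graph T).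

(** Edges have three elements, so the two assumptions force [a, x, y] and [a, x, z] to be distinct,
    and the conclusion is immediate for [y = z]. *)
Definition link_triangle_free : Prop := forall a x y z,
  [set a; x; y] \in edges G -> [set a; x; z] \in edges G ->
  [set a; y; z] \notin edges G.

Lemma card_edge e : e \in edges G -> #|e| = 3.
Proof. by move=> eG; apply/eqP/(forall_inP (edges_uniform G)). Qed.

Lemma edge_uniq a b c : [set a; b; c] \in edges G -> uniq [:: a; b; c].
Proof. by move/card_edge/eqP; rewrite card_set3_uniq. Qed.

Lemma independent3U1 (A : {set T}) v : independent3 G A ->
    (forall b c, b \in A -> c \in A -> [set b; c; v] \notin edges G) ->
  independent3 G (v |: A).
Proof.
move=> /forall_inP indA vA; apply/forall_inP => e eG.
apply/negP => sub; have [ve|ve] := boolP (v \in e); last first.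
  case/negP: (indA e eG); apply/subsetP => x xe.
  have := subsetP sub x xe; rewrite !inE => /predU1P[xv|//].
  by rewrite -xv xe in ve.
have [b [c [eq_e be ce]]] := set3_of_mem (card_edge eG) ve.
have := edge_uniq; rewrite eq_e in eG *; move/(_ _ _ _ eG).
rewrite /= !inE negb_or andbT => /andP[/andP[bc bv] cv].
have bA : b \in A by have := subsetP sub _ be; rewrite !inE (negPf bv).
have cA : c \in A by have := subsetP sub _ ce; rewrite !inE (negPf cv).
by have := vA b c bA cA; rewrite eG.
Qed.

(* [A] is the independent set built so far and [X] the set of candidates.
   [D] collects the members of [A] whose links have no edge left inside [X];
   a vertex of large degree in the link of [a] lets [a] join [D], since its
   neighbourhood spans no edge of that triangle-free link. *)
Lemma greedy_independent n s (A D X : {set T}) : link_triangle_free ->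
    D \subset A -> [disjoint A & X] -> independent3 G A -> #|A| <= n ->
    (forall a b x, a \in A -> b \in A -> x \in X -> [set a; b; x] \notin edges G) ->
    (forall a x y, a \in D -> x \in X -> y \in X -> [set a; x; y] \notin edges G) ->
    (n - #|A|) + (n - #|D|) <= s -> (4 * n) ^ s <= #|X| ->
  exists2 S : {set T}, independent3 G S & #|S| = n.
Proof.
(* [s] bounds the number of remaining moves: each move enlarges [A] or [D], and when none is left
   [#|A| = n]. *)
move=> free; elim: s A D X => [|s IH] A D X DA AX indA An noAA noD sle Xbig.
  by exists A => //; move: (subset_leq_card DA) => ?; lia.
have [An'|An'] := eqVneq #|A| n; first by exists A.
have {An An'}An : #|A| < n by rewrite ltn_neqAle An'.
have DleA := subset_leq_card DA.
pose N a v := [set x in X | [set a; v; x] \in edges G].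
have [/existsP[a /existsP[v /and4P[aA aD vX big]]]|small] := boolP
    [exists a, exists v, [&& a \in A, a \notin D, v \in X & #|X| <= 4 * n * #|N a v|]].
  apply: (IH A (a |: D) (N a v)) => //.
  - by rewrite subUset sub1set aA.
  - by apply: disjointWr AX; apply/subsetP => x; rewrite inE => /andP[].
  - exact: ltnW.
  - by move=> b c x bA cA; rewrite inE => /andP[xX _]; apply: noAA.
  - move=> b x y; rewrite !inE => /predU1P[->|bD] /andP[xX ex] /andP[yX ey].
      exact: free ex ey.
    exact: noD.
  - by rewrite cardsU1 aD; lia.
  - move: Xbig; rewrite expnS => Xbig.
    have : 4 * n * (4 * n) ^ s <= 4 * n * #|N a v| by apply: leq_trans big.
    by rewrite leq_pmul2l //; lia.
have /card_gt0P[v vX] : 0 < #|X| by apply: leq_trans Xbig; rewrite expn_gt0; lia.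
have vA : v \notin A by apply: contraL vX => /(disjointFr AX) ->.
(* After this deletion no edge joins [v], a member of [A] and a candidate; links of members of [D]
   have no edge inside [X] anyway. *)
pose X' := X :\ v :\: \bigcup_(a in A :\: D) N a v.
have X'P x : x \in X' ->
    [/\ x \in X, x != v & forall a, a \in A -> [set a; v; x] \notin edges G].
  rewrite !inE => /and3P[xN xv xX]; split=> // a aA.
  have [aD|aD] := boolP (a \in D); first exact: noD.
  apply: contraNN xN => e; apply/bigcupP; exists a; first by rewrite inE aD.
  by rewrite inE xX.
have X'X : X' \subset X by apply/subsetP => x /X'P[].
apply: (IH (v |: A) D X') => //.
- by apply: subset_trans DA (subsetUr _ _).
- rewrite disjoints_subset subUset sub1set -disjoints_subset (disjointWr X'X AX).
  by rewrite !inE eqxx andbF.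
- by apply: independent3U1 => // b c bA cA; apply: noAA.
- by rewrite cardsU1 vA.
- move=> a b x + + /X'P[xX xv xA]; rewrite !inE.
  move=> /predU1P[->|aA] /predU1P[->|bA].
  + by apply/negP => /edge_uniq /=; rewrite inE eqxx.
  + have -> : [set v; b; x] = [set b; v; x] by rewrite (setUC [set v]).
    exact: xA.
  + exact: xA.
  + exact: noAA.
- by move=> a x y aD /(subsetP X'X) xX /(subsetP X'X); apply: noD.
- by rewrite cardsU1 vA; lia.
(* At most [n] sets of size at most [|X| / (4n)] are removed, so with [v] the loss is at most
   [|X| / 4 + 1]. *)
- have Nsmall a : a \in A :\: D -> 4 * n * #|N a v| <= #|X|.
    rewrite inE => /andP[aD aA]; rewrite leqNgt; apply: contraNN small => lt.
    by apply/existsP; exists a; apply/existsP; exists v; rewrite aA aD vX ltnW.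
  have cupX : 4 * n * #|\bigcup_(a in A :\: D) N a v| <= n * #|X|.
    apply: (@leq_trans (4 * n * \sum_(a in A :\: D) #|N a v|)).
      rewrite leq_mul2l; apply/orP; right.
      elim/big_rec2: _ => [|a B m _ Bm]; first by rewrite cards0.
      by apply: leq_trans (leq_card_setU _ _).1 _; rewrite leq_add2l.
    rewrite big_distrr /=; apply: (@leq_trans (\sum_(a in A :\: D) #|X|)).
      exact: leq_sum.
    rewrite sum_nat_const leq_mul2r; apply/orP; right.
    by rewrite (leq_trans _ (ltnW An)) // subset_leq_card // subsetDl.
  have cX := cardsD1 v X; rewrite vX in cX.
  have := cardsD (X :\ v) (\bigcup_(a in A :\: D) N a v).
  have := subset_leq_card (subsetIr (X :\ v) (\bigcup_(a in A :\: D) N a v)).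
  rewrite -/X'; move: Xbig cupX; rewrite expnS.
  move: (#|\bigcup_(a in A :\: D) N a v|) => c.
  have : 0 < (4 * n) ^ s by rewrite expn_gt0; lia.
  move: ((4 * n) ^ s) => E E0 Xbig cupX c1 c2.
  have h : 4 * c <= #|X| by rewrite -(@leq_pmul2l n); lia.
  by nia.
Qed.

Lemma independent_of_large_link_triangle_free n : link_triangle_free ->
  (4 * n) ^ (n + n) <= #|T| -> exists2 S : {set T}, independent3 G S & #|S| = n.
Proof.
move=> free big; apply: (@greedy_independent n (n + n) set0 set0 setT) => //.
- by rewrite disjoints_subset sub0set.
- apply/forall_inP => e eG; apply/negP => /subset_leq_card.
  by rewrite cards0 (card_edge eG).
- by rewrite cards0.
- by move=> a b x; rewrite inE.
- by move=> a b x; rewrite inE.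
- by rewrite cards0 subn0.
- by rewrite cardsT.
Qed.

(** A triangle [x y z] in the link of [a] is three edges on four vertices. *)
Lemma link_triangle_free_of_four_span : four_span_le2 G -> link_triangle_free.
Proof.
move=> /forallP span a x y z exy exz; apply/negP => eyz.
have uxy := edge_uniq exy; have uxz := edge_uniq exz; have uyz := edge_uniq eyz.
have U4 : uniq [:: a; x; y; z].
  by move: uxy uxz uyz; rewrite /= !inE !negb_or !andbT;
     move=> /andP[/andP[-> ->] ->] /andP[/andP[_ ->] ->] /andP[_ ->].
have := span [set a; x; y; z].
have -> : #|[set a; x; y; z]| = 4.
  rewrite -[RHS](card_uniqP U4); apply: eq_card => t; by rewrite !inE !orbA.
rewrite eqxx /= leqNgt => /negP; apply.
have <- : #|[set [set a; x; y]; [set a; x; z]; [set a; y; z]]| = 3.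
  apply/eqP; rewrite card_set3_uniq /= !inE negb_or andbT -andbA.
  move: U4; rewrite /= !inE !negb_or !andbT => /and3P[/and3P[ax ay az] /andP[xy xz] yz].
  apply/and3P; split; apply/eqP => /setP.
  - move/(_ y); rewrite !inE eqxx orbT (eq_sym y a) (negPf ay) (eq_sym y x).
    by rewrite (negPf xy) (negPf yz).
  - by move/(_ x); rewrite !inE eqxx orbT (eq_sym x a) (negPf ax) (negPf xy) (negPf xz).
  - by move/(_ x); rewrite !inE eqxx orbT (eq_sym x a) (negPf ax) (negPf xy) (negPf xz).
apply: subset_leq_card; apply/subsetP => e; rewrite !inE -orbA.
by case/or3P => /eqP ->; rewrite ?exy ?exz ?eyz /=; apply/subsetP => t;
  rewrite !inE; case: (t == a); case: (t == x); case: (t == y); case: (t == z).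
Qed.

(** Three edges inside a 4-set [S] have the form [S :\ x], [S :\ y], [S :\ z]; the fourth vertex
    lies in all three, and its link contains the triangle [x y z]. *)
Lemma four_span_of_link_triangle_free : link_triangle_free -> four_span_le2 G.
Proof.
move=> free; apply/forallP => S; apply/implyP => /eqP S4.
rewrite leqNgt; apply/negP => big.
pose M := [set x in S | S :\ x \in edges G].
have : 2 < #|M|.
  apply: leq_trans big (leq_trans _ (leq_imset_card (fun x => S :\ x) M)).
  apply: subset_leq_card; apply/subsetP => e; rewrite inE => /andP[eG eS].
  have /cards1P[x eqx] : #|S :\: e| == 1.
    by rewrite cardsD (setIidPr eS) S4 (card_edge eG).
  have /setDP[xS xe] : x \in S :\: e by rewrite eqx set11.
  have eqe : e = S :\ x by rewrite -eqx setDDr setDv set0U (setIidPr eS).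
  by apply/imsetP; exists x => //; rewrite inE xS -eqe.
case/card_gt2P => x [y [z [[]]]]; rewrite !inE.
move=> /andP[xS ex] /andP[yS ey] /andP[zS ez] [xy yz zx].
have /cards1P[a eqa] : #|S :\ x :\ y :\ z| == 1.
  have := cardsD1 x S; have := cardsD1 y (S :\ x); have := cardsD1 z (S :\ x :\ y).
  rewrite !inE xS yS zS (eq_sym y) xy zx (eq_sym z) yz /= S4; lia.
have mem_S t : (t \in S) = [|| t == a, t == x, t == y | t == z].
  move/setP: eqa => /(_ t); rewrite !inE.
  case: eqVneq => [->|_]; first by rewrite zS !orbT.
  case: eqVneq => [->|_]; first by rewrite yS !orbT.
  case: eqVneq => [->|_]; first by rewrite xS !orbT.
  by move=> /= ->; rewrite !orbF.
have : a \in S :\ x :\ y :\ z by rewrite eqa set11.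
rewrite !inE => /and4P[az ay ax aS].
have Dx : S :\ x = [set a; y; z].
  apply/setP => t; rewrite !inE mem_S; have [->|_] := eqVneq t x.
    by rewrite (eq_sym x a) (negPf ax) (negPf xy) (eq_sym x z) (negPf zx).
  by case: (t == a); case: (t == x); case: (t == y).
have Dy : S :\ y = [set a; x; z].
  apply/setP => t; rewrite !inE mem_S; have [->|_] := eqVneq t y.
    by rewrite (eq_sym y a) (negPf ay) (eq_sym y x) (negPf xy) (negPf yz).
  by case: (t == a); case: (t == x); case: (t == y).
have Dz : S :\ z = [set a; x; y].
  apply/setP => t; rewrite !inE mem_S; have [->|_] := eqVneq t z.
    by rewrite (eq_sym z a) (negPf az) (negPf zx) (eq_sym z y) (negPf yz).
  by case: (t == a); case: (t == x); case: (t == y).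
by rewrite Dx in ex; rewrite Dy in ey; rewrite Dz in ez; have := free _ _ _ _ ez ey; rewrite ex.
Qed.

(** The missing triple of [K4_minus_e] is the one avoiding [ord_max], so a copy puts a triangle into
    the link of the image of [ord_max]. *)
Lemma no_copy_of_link_triangle_free :
  link_triangle_free -> ~ contains_copy G K4_minus_e.
Proof.
move=> free [f [fI fG]].
pose o k (lt : k < 4) : 'I_4 := Ordinal lt.
have E (b c : 'I_4) : uniq [:: ord_max; b; c] -> [set f ord_max; f b; f c] \in edges G.
  move=> u; have -> : [set f ord_max; f b; f c] = f @: [set ord_max; b; c].
    by rewrite !imsetU !imset_set1.
  apply: fG; rewrite !inE card_set3_uniq u.
  by apply/eqP => /setP /(_ ord_max); rewrite !inE eqxx.
have := free _ _ _ _ (E (o 0 isT) (o 1 isT) isT) (E (o 0 isT) (o 2 isT) isT).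
by rewrite (E (o 1 isT) (o 2 isT) isT).
Qed.

Lemma link_triangle_free_of_no_copy :
  ~ contains_copy G K4_minus_e -> link_triangle_free.
Proof.
move=> nc a x y z exy exz; apply/negP => eyz; apply: nc.
have uxy := edge_uniq exy; have uxz := edge_uniq exz; have uyz := edge_uniq eyz.
have U4 : uniq [:: x; y; z; a].
  move: uxy uxz uyz; rewrite /= !inE !negb_or !andbT !(eq_sym a).
  by move=> /andP[/andP[-> ->] ->] /andP[/andP[_ ->] ->] /andP[_ ->].
(* The apex [a] sits at position [ord_max], which every edge of [K4_minus_e] contains. *)
exists (tnth [tuple x; y; z; a]); split.
  by apply/tuple_uniqP.
move=> e; rewrite !inE => /andP[/eqP e3 ne].
have me : ord_max \in e.
  apply: contraNT ne => me; rewrite eqEcard cardsC1 card_ord e3 andbT.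
  by apply/subsetP => t te; rewrite !inE; apply: contraNneq me => <-.
have [b [c [eqe be ce]]] := set3_of_mem e3 me.
have : uniq [:: b; c; ord_max] by rewrite -card_set3_uniq -eqe e3.
have perm (u v : T) : [set u; v; a] = [set a; u; v].
  by apply/setP => t; rewrite !inE; case: (t == a); rewrite ?orbT ?orbF.
have swap (u v : T) : [set a; u; v] = [set a; v; u].
  by apply/setP => t; rewrite !inE -!orbA (orbC (t == u)).
rewrite eqe !imsetU !imset_set1.
case: b {be eqe} => [[|[|[|[|//]]]] bP]; case: c {ce} => [[|[|[|[|//]]]] cP] //= _;
  rewrite !(tnth_nth a) /= perm //; by rewrite swap.
Qed.

Lemma compl3_complete_copyP n :
  contains_copy (compl3 G) (K3 n) <-> exists2 S, independent3 G S & #|S| = n.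
Proof.
split=> [[f [fI fG]]|[S /forall_inP indS Sn]].
  exists (f @: setT); last by rewrite card_imset // cardsT card_ord.
  apply/forall_inP => e eG; apply/negP => /subsetP sub.
  have eqe : e = f @: (f @^-1: e).
    apply/setP => t; apply/idP/imsetP => [te|[u + ->]]; last by rewrite inE.
    by have /imsetP[u _ eqt] := sub t te; exists u => //; rewrite inE -eqt.
  have := fG (f @^-1: e); rewrite -eqe !inE eG andbF andbT => h.
  by suff : false by []; apply: h; rewrite -(card_imset _ fI) -eqe (card_edge eG).
pose f (i : 'I_n) := enum_val (cast_ord (esym Sn) i).
have fI : injective f by move=> i j /enum_val_inj /cast_ord_inj.
exists f; split=> // e; rewrite !inE andbT => e3.
rewrite card_imset // e3 /=; apply: contraTN (_ : f @: e \subset S) => [|].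
  exact: indS.
by apply/subsetP => _ /imsetP[i _ ->]; apply: enum_valP.
Qed.

Lemma independence_number_ge (S : {set T}) :
  independent3 G S -> #|S| <= independence_number G.
Proof.
move=> indS; rewrite /independence_number.
exact: (@leq_bigmax_cond _ (independent3 G) (fun S : {set T} => #|S|)).
Qed.

(** Subsets of independent sets are independent, so excluding size [n] excludes all larger sizes. *)
Lemma independence_number_lt n : 0 < n ->
    (forall S : {set T}, independent3 G S -> #|S| <> n) ->
  independence_number G < n.
Proof.
case: n => // n _ noS; rewrite ltnS; apply/bigmax_leqP => S /forall_inP indS.
rewrite leqNgt; apply/negP => /card_geqP[s [us sn sS]].
apply: (noS [set x in s]); last by rewrite cardsE (card_uniqP us).
apply/forall_inP => e eG; apply: contraNN (indS e eG) => /subset_trans; apply.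
by apply/subsetP => x; rewrite inE; apply: sS.
Qed.

End ThreeGraphFacts.

(** * Both extremal quantities in terms of link-triangle-free 3-graphs *)

Lemma ramsey_propertyP n N : ramsey_property K4_minus_e (K3 n) N <->
  forall G : three_graph 'I_N, link_triangle_free G ->
    exists2 S, independent3 G S & #|S| = n.
Proof.
split=> [h G free|h G].
  by case: (h G) => [/(no_copy_of_link_triangle_free free)//|/compl3_complete_copyP].
have [?|nc] := pselect (contains_copy G K4_minus_e); first by left.
by right; apply/compl3_complete_copyP/h/link_triangle_free_of_no_copy.
Qed.

Lemma empty3_four_span (T : finType) : four_span_le2 (empty3 T).
Proof.
apply/forallP => S; apply/implyP => _.
by rewrite (_ : [set e in _ | _] = set0) ?cards0 //; apply/setP => e; rewrite !inE andbF.
Qed.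

Lemma min_independence_number_le N (G : three_graph 'I_N) :
  link_triangle_free G -> min_independence_number N <= independence_number G.
Proof.
move=> /four_span_of_link_triangle_free spanG; rewrite /min_independence_number.
by case: arg_minnP => [|H _]; [exact: empty3_four_span | apply].
Qed.

Lemma min_independence_numberP N : exists2 G : three_graph 'I_N,
  link_triangle_free G & min_independence_number N = independence_number G.
Proof.
rewrite /min_independence_number; case: arg_minnP => [|H spanH _].
  exact: empty3_four_span.
by exists H => //; apply: link_triangle_free_of_four_span.
Qed.

(** * The discrete cube *)

Local Open Scope ring_scope.

Lemma big_tuple_cons (T : finType) (V : nmodType) k (F : k.+1.-tuple T -> V) :
  \sum_t F t = \sum_b \sum_(t : k.-tuple T) F [tuple of b :: t].
Proof.
rewrite pair_big /=.
rewrite (reindex (fun p : T * k.-tuple T => [tuple of p.1 :: p.2])) //=.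
exists (fun t : k.+1.-tuple T => (thead t, [tuple of behead t])) => [[b t]|t] _ /=.
  by congr (_, _); apply: val_inj.
by rewrite [RHS]tuple_eta.
Qed.

(** Taken on sequences so that an induction on tuples can peel off the first bit by computation. *)
Definition hamming (s t : seq bool) : nat :=
  count (fun p : bool * bool => p.1 != p.2) (zip s t).

(* Crossing the products: u = f0 g1 and v = f1 g0 satisfy
   u v = (f0 g0)(f1 g1) <= 1, which beats the trivial bound u + v <= 2K. *)
Lemma cross_products_le (R : realFieldType) (K C f0 f1 g0 g1 : R) :
    1 <= K -> 0 <= C -> 0 <= f0 -> 0 <= f1 -> 0 <= g0 -> 0 <= g1 ->
    f0 * g0 <= C -> f1 * g1 <= C -> f0 * g1 <= K * C -> f1 * g0 <= K * C ->
  (f0 + f1) * (g0 + g1) <= (2 + K + K^-1) * C.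
Proof.
move=> K1 C0 f00 f10 g00 g10 h00 h11 h01 h10.
have K0 : 0 < K by lra.
have uv : (f0 * g1) * (f1 * g0) <= C * C.
  have -> : (f0 * g1) * (f1 * g0) = (f0 * g0) * (f1 * g1) by ring.
  by apply: ler_pM => //; apply: mulr_ge0.
have s : f0 * g1 + f1 * g0 <= (K + K^-1) * C.
  case: (eqVneq C 0) => [C00|CN0]; first by move: h01 h10; rewrite C00; lra.
  have Cgt0 : 0 < C by rewrite lt_neqAle eq_sym CN0.
  (* Expanding this product and using [u v <= C^2] bounds [K C (u + v)] by [K^2 C^2 + C^2]. *)
  have h : 0 <= (K * C - f0 * g1) * (K * C - f1 * g0) by apply: mulr_ge0; lra.
  have : (K * C) * (f0 * g1 + f1 * g0) <= (K * C) * ((K + K^-1) * C).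
    have -> : (K * C) * ((K + K^-1) * C) = K ^+ 2 * C ^+ 2 + C ^+ 2.
      by field; rewrite gt_eqF.
    by lra.
  by rewrite ler_pM2l // mulr_gt0.
lra.
Qed.

(** Tensorization: split [f] and [g] by the first bit. The four products of half-sums obey the bound
    in dimension [k], with an extra factor [K] when the first bits differ, and [cross_products_le]
    combines them. *)
Lemma tuple_two_function_bound (R : realFieldType) (K : R) k (M : R)
    (f g : k.-tuple bool -> R) : 1 <= K -> 0 <= M ->
    (forall x, 0 <= f x) -> (forall x, 0 <= g x) ->
    (forall x y, f x * g y <= M * K ^+ hamming x y) ->
  (\sum_x f x) * (\sum_x g x) <= M * (2 + K + K^-1) ^+ k.
Proof.
move=> K1; elim: k M f g => [|k IH] M f g M0 f0 g0 h.
  rewrite (big_pred1 [tuple]) => [|x]; last by apply/esym/eqP/tuple0.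
  rewrite (big_pred1 [tuple]) => [|x]; last by apply/esym/eqP/tuple0.
  exact: h.
have K0 : 0 <= K by lra.
rewrite !big_tuple_cons !big_bool exprS mulrCA.
have M'0 : 0 <= M * (2 + K + K^-1) ^+ k.
  by rewrite mulr_ge0 // exprn_ge0 // !addr_ge0 // invr_ge0.
apply: cross_products_le => //; try by apply: sumr_ge0.
- by apply: IH => // x y; have := h [tuple of true :: x] [tuple of true :: y].
- by apply: IH => // x y; have := h [tuple of false :: x] [tuple of false :: y].
- rewrite mulrA; apply: IH => // [|x y]; first exact: mulr_ge0.
  have := h [tuple of true :: x] [tuple of false :: y].
  by rewrite /hamming /= exprS; lra.
- rewrite mulrA; apply: IH => // [|x y]; first exact: mulr_ge0.
  have := h [tuple of false :: x] [tuple of true :: y].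
  by rewrite /hamming /= exprS; lra.
Qed.

Lemma hamming_fgraph (T : finType) (x y : {ffun T -> bool}) :
  hamming (fgraph x) (fgraph y) = #|[set t | x t != y t]|.
Proof.
rewrite /hamming -!codom_ffun /codom /image_mem zip_map count_map.
by rewrite -sum1_count big_enum_cond /= sum1_card cardsE; apply: eq_card.
Qed.

Lemma sum_fgraph (T : finType) (V : nmodType) (F : {ffun T -> bool} -> V) :
  \sum_x F x = \sum_(t : #|T|.-tuple bool) F (Finfun t).
Proof.
apply: (reindex (@Finfun T bool)); exists (@fgraph T bool) => x _.
  exact: FinfunK.
exact: fgraphK.
Qed.

(** The two-function bound for the indicators of [A] and [B], with constant [M^-1]. *)
Lemma cube_separated_sets (R : realFieldType) (K M : R) (T : finType)
    (A B : {set {ffun T -> bool}}) : 1 <= K -> 0 <= M ->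
    (forall x y, x \in A -> y \in B -> M <= K ^+ #|[set t | x t != y t]|) ->
  M * (#|A|%:R * #|B|%:R) <= (2 + K + K^-1) ^+ #|T|.
Proof.
move=> K1 M0 sep.
have indic (S : {set {ffun T -> bool}}) :
    \sum_(t : #|T|.-tuple bool) (Finfun t \in S)%:R = #|S|%:R :> R.
  by rewrite -(sum_fgraph (fun x => (x \in S)%:R)) -natr_sum -big_mkcond /= sum1_card.
have K0 : 0 < K by lra.
move: M0; rewrite le_eqVlt => /predU1P[<-|M0].
  by rewrite mul0r exprn_ge0 // !addr_ge0 // ?invr_ge0; lra.
rewrite -ler_pdivlMl // -!indic.
apply: tuple_two_function_bound => //; first by rewrite invr_ge0 ltW.
move=> x y.
rewrite ler_pdivlMl //.
case: (boolP (Finfun x \in A)) => xA; last by rewrite mul0r mulr0 exprn_ge0 ?ltW.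
case: (boolP (Finfun y \in B)) => yB; last by rewrite !mulr0 exprn_ge0 ?ltW.
rewrite !mulr1; have := sep _ _ xA yB.
by rewrite -hamming_fgraph !FinfunK.
Qed.

(** * Counting in subcubes and fibres *)

Lemma card_cube_subcube (T : finType) (J : {set T}) (y : T -> bool) :
  (#|[set x : {ffun T -> bool} | [forall t in J, x t == y t]]| * 2 ^ #|J|
    = 2 ^ #|T|)%N.
Proof.
have -> : #|[set x : {ffun T -> bool} | [forall t in J, x t == y t]]|
    = #|family (fun t => mem (if t \in J then pred1 (y t) else predT))|.
  rewrite cardsE; apply: eq_card => x; rewrite !inE; apply: eq_forallb => t.
  by rewrite /finfun.fmem /=; case: (t \in J).
rewrite card_family foldrE big_map big_enum /=.
rewrite -[in RHS]cardsT -!prod_nat_const [X in (_ * X)%N]big_mkcond /=.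
rewrite -big_split /= [RHS]big_mkcond /=.
apply: eq_bigr => t _; rewrite inE; case: (t \in J); first by rewrite card1.
by rewrite card_bool.
Qed.

(* [x t (+) x (p t)] on [J] is a triangular change of coordinates. *)
Lemma card_cube_differ (T : finType) (J : {set T}) (p : T -> T) :
    (forall t, t \in J -> p t \notin J) ->
  (#|[set x : {ffun T -> bool} | [forall t in J, x t != x (p t)]]| * 2 ^ #|J|
    = 2 ^ #|T|)%N.
Proof.
move=> pJ; rewrite -(card_cube_subcube J (fun=> true)); congr (_ * _)%N.
pose h (x : {ffun T -> bool}) := [ffun t => if t \in J then x t (+) x (p t) else x t].
have hK : involutive h.
  move=> x; apply/ffunP => t; rewrite !ffunE.
  case: (boolP (t \in J)) => // tJ; rewrite (negPf (pJ _ tJ)).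
  by rewrite -addbA addbb addbF.
rewrite -(card_imset _ (can_inj hK)); apply: eq_card => x.
rewrite -[x in LHS]hK (mem_imset _ _ (can_inj hK)) !inE.
apply: eq_forallb_in => t tJ; rewrite !ffunE tJ (negPf (pJ _ tJ)).
by rewrite addbC; case: (x (p t)); case: (x t).
Qed.

(** The fibres of restriction along [h] are subcubes with the coordinates in the image of [h] fixed,
    so all have the same size. *)
Lemma card_cube_pullback (S T : finType) (h : S -> T)
    (P : pred {ffun S -> bool}) : injective h ->
  (#|[set x : {ffun T -> bool} | P [ffun s => x (h s)]]| * 2 ^ #|S|
    = #|[set y | P y]| * 2 ^ #|T|)%N.
Proof.
move=> hI.
pose r (x : {ffun T -> bool}) := [ffun s => x (h s)].
rewrite -sum1_card (partition_big r (mem [set y | P y])) /=; last first.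
  by move=> x; rewrite !inE.
rewrite big_distrl /= -sum_nat_const.
apply: eq_bigr => y; rewrite inE => Py.
pose y' t := if [pick s | h s == t] is Some s then y s else false.
rewrite -(card_cube_subcube [set h s | s : S] y') (card_imset _ hI); congr (_ * _)%N.
rewrite -sum1_card; apply: eq_bigl => x; rewrite !inE.
have y'h s : y' (h s) = y s.
  by rewrite /y'; case: pickP => [s' /eqP /hI -> //|/(_ s)]; rewrite eqxx.
apply/andP/forall_inP => [[_ /eqP rx] _ /imsetP[s _ ->]|e].
  by rewrite y'h -rx ffunE.
have rx : r x = y.
  by apply/ffunP => s; rewrite ffunE -y'h; apply/eqP/e/imset_f.
by rewrite -/(r x) rx.
Qed.

Local Close Scope ring_scope.

(** * Alignment graphs *)

Local Notation config V d := {ffun V * V * 'I_d -> bool}.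

Section AlignmentGraph.
Variables (V : finType) (d : nat).
Implicit Types (w : config V d) (a b c u v : V).

Definition aligned w a b c (i : 'I_d) : bool :=
  [&& w (a, b, i) != w (a, c, i), w (b, a, i) != w (b, c, i)
    & w (c, a, i) != w (c, b, i)].

(** The threshold [2d/3] is what makes any three such sets of indices intersect. *)
Definition majority w a b c : bool := 2 * d < 3 * #|[set i | aligned w a b c i]|.

(* The set version of [aligned], free of any order on the three vertices. *)
Definition splits w (e : {set V}) (i : 'I_d) : bool :=
  [forall a in e, forall b in e, forall c in e,
    uniq [:: a; b; c] ==> (w (a, b, i) != w (a, c, i))].

Definition alignment_graph w : three_graph V :=
  three_graph_of [set e | 2 * d < 3 * #|[set i | splits w e i]|].

Lemma splitsP w e i a b c : splits w e i -> a \in e -> b \in e -> c \in e ->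
  uniq [:: a; b; c] -> w (a, b, i) != w (a, c, i).
Proof.
move=> /forall_inP h ae be ce.
by apply/implyP; have /forall_inP := h a ae => /(_ b be) /forall_inP; apply.
Qed.

Lemma aligned_uniq w a b c i : aligned w a b c i -> uniq [:: a; b; c].
Proof.
case/and3P => h1 h2 h3; rewrite /= !inE negb_or !andbT -andbA.
by apply/and3P; split; [move: h3 | move: h2 | move: h1]; apply: contraNneq => ->.
Qed.

Lemma splits_aligned w a b c i : aligned w a b c i -> splits w [set a; b; c] i.
Proof.
case/and3P => h1 h2 h3; do 3! (apply/forall_inP => ?; rewrite !inE -orbA => ?).
apply/implyP; rewrite /= !inE negb_or andbT.
by do 3! match goal with H : is_true [|| _ == _, _ == _ | _ == _] |- _ =>
   case/or3P: H => /eqP -> end; rewrite ?eqxx /= ?andbF // => _; rewrite // eq_sym.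
Qed.

Lemma alignment_graph_free w : link_triangle_free (alignment_graph w).
Proof.
move=> a x y z; rewrite !inE !card_set3_uniq => /andP[uxy xy] /andP[uxz xz].
apply/negP => /andP[uyz yz].
pose S (e : {set V}) := [set i | splits w e i].
have [i] : exists i, i \in S [set a; x; y] :&: S [set a; x; z] :&: S [set a; y; z].
  apply/card_gt0P.
  have := cardsUI (S [set a; x; y]) (S [set a; x; z]).
  have := cardsUI (S [set a; x; y] :&: S [set a; x; z]) (S [set a; y; z]).
  have := subset_leq_card (subsetT (S [set a; x; y] :|: S [set a; x; z])).
  have := subset_leq_card
    (subsetT (S [set a; x; y] :&: S [set a; x; z] :|: S [set a; y; z])).
  by rewrite /S cardsT card_ord; lia.
rewrite !inE => /andP[/andP[sxy sxz] syz].
have := splitsP sxy _ _ _ uxy; have := splitsP sxz _ _ _ uxz.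
have := splitsP syz _ _ _ uyz; rewrite !inE !eqxx !orbT.
move=> /(_ isT isT isT) + /(_ isT isT isT) + /(_ isT isT isT).
by case: (w (a, x, i)); case: (w (a, y, i)); case: (w (a, z, i)).
Qed.

End AlignmentGraph.

(** Moves a question about an [n]-set of vertices to the fixed vertex type ['I_n], so that one count
    serves all [n]-sets. *)
Definition pull_config (V W : finType) d (g : W -> V) (w : config V d) : config W d :=
  [ffun t => w (g t.1.1, g t.1.2, t.2)].

Definition majority_free (V : finType) d (w : config V d) : bool :=
  [forall a, forall b, forall c, ~~ majority w a b c].

Lemma majority_free_pull (V W : finType) d (g : W -> V) (w : config V d) :
    injective g -> independent3 (alignment_graph w) (g @: setT) ->
  majority_free (pull_config g w).
Proof.
move=> gI /forall_inP ind; apply/forallP => a; apply/forallP => b.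
apply/forallP => c; apply/negP => maj.
have sub : [set i | aligned (pull_config g w) a b c i]
    \subset [set i | splits w [set g a; g b; g c] i].
  apply/subsetP => i; rewrite !inE => al; apply: splits_aligned.
  by move: al; rewrite /aligned !ffunE.
have [i] : exists i, i \in [set i | aligned (pull_config g w) a b c i].
  by apply/card_gt0P; move: maj; rewrite /majority; lia.
rewrite inE => /aligned_uniq u.
have /ind/negP : [set g a; g b; g c] \in edges (alignment_graph w).
  rewrite !inE card_set3_uniq -[[:: g a; _; _]]/(map g [:: a; b; c]) map_inj_uniq // u.
  by apply: leq_trans maj _; rewrite leq_mul2l subset_leq_card.
apply; apply/subsetP => t; rewrite !inE -orbA.
by case/or3P => /eqP ->; apply: imset_f.
Qed.

(** * Codegrees of triples aligned at every index *)

Section Codegree.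
Variables (V : finType) (d : nat).
Implicit Types (w : config V d) (a b c u v : V).

Definition strong w a b c : bool := [forall i, aligned w a b c i].

Definition codegree w u v : nat := \sum_c strong w u v c.

Definition changed w w' u v : nat := #|[set i | w (u, v, i) != w' (u, v, i)]|.

Lemma strongC w a b c : strong w a b c = strong w b a c.
Proof.
apply: eq_forallb => i; rewrite /aligned andbCA; congr [&& _, _ & _].
by rewrite eq_sym.
Qed.

Lemma strongAC w a b c : strong w a b c = strong w a c b.
Proof.
apply: eq_forallb => i; rewrite /aligned eq_sym; congr (_ && _).
exact: andbC.
Qed.

Lemma distance_changed w w' :
  #|[set t | w t != w' t]| = \sum_u \sum_v changed w w' u v.
Proof.
rewrite pair_big /= -sum1_card /changed.
under [RHS]eq_bigr do rewrite -sum1_card.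
rewrite pair_big_dep /=; apply: eq_big => [[[u v] i]|//].
by rewrite !inE.
Qed.

Lemma changed_le w w' u v : changed w w' u v <= d.
Proof. by rewrite -[X in _ <= X]card_ord max_card. Qed.

(** At least [d/3] indices are not aligned for [w'], and each needs one of the six bits on the
    triple to have changed. *)
Lemma strong_changed w w' a b c : majority_free w' -> strong w a b c ->
  d <= 3 * (changed w w' a b + changed w w' b a + changed w w' a c
            + changed w w' c a + changed w w' b c + changed w w' c b).
Proof.
move=> /forallP/(_ a)/forallP/(_ b)/forallP/(_ c) + /forallP st.
rewrite -leqNgt => maj.
pose D x y := [set i | w (x, y, i) != w' (x, y, i)].
pose U := D a b :|: D b a :|: D a c :|: D c a :|: D b c :|: D c b.
have cov : ~: [set i | aligned w' a b c i] \subset U.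
  apply/subsetP => i; rewrite !inE; apply: contraNT; rewrite !negb_or !negbK.
  move=> /andP[/andP[/andP[/andP[/andP[/eqP e1 /eqP e2] /eqP e3] /eqP e4] /eqP e5] /eqP e6].
  by have := st i; rewrite /aligned e1 e2 e3 e4 e5 e6.
have := subset_leq_card cov; have := cardsC [set i | aligned w' a b c i].
rewrite card_ord.
have U1 := (leq_card_setU (D a b :|: D b a :|: D a c :|: D c a :|: D b c) (D c b)).1.
have U2 := (leq_card_setU (D a b :|: D b a :|: D a c :|: D c a) (D b c)).1.
have U3 := (leq_card_setU (D a b :|: D b a :|: D a c) (D c a)).1.
have U4 := (leq_card_setU (D a b :|: D b a) (D a c)).1.
have U5 := (leq_card_setU (D a b) (D b a)).1.
rewrite -/U in U1; rewrite -!/(#|D _ _|) /changed -!/(D _ _).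
by lia.
Qed.

(** Sum [strong_changed] over all triples. As [strong] is symmetric, the six terms have equal sums,
    whence [18 = 3 * 6]. *)
Lemma codegree_changed w w' : majority_free w' ->
  d * (\sum_u \sum_v codegree w u v)
    <= 18 * (\sum_u \sum_v changed w w' u v * codegree w u v).
Proof.
move=> mf; set W := changed w w'; set S := (X in 18 * X).
pose S3 (F : V -> V -> V -> nat) := \sum_a \sum_b \sum_c F a b c.
have S3C F : S3 F = S3 (fun a b c => F b a c) by rewrite /S3 exchange_big.
have S3AC F : S3 F = S3 (fun a b c => F a c b).
  by apply: eq_bigr => a _; rewrite exchange_big.
have eqS3 F F' : (forall a b c, F a b c = F' a b c) -> S3 F = S3 F'.
  by move=> e; do 3! (apply: eq_bigr => ? _).
have W1 : S3 (fun a b c => W a b * strong w a b c) = S.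
  by do 2! (apply: eq_bigr => ? _); rewrite -big_distrr.
have W2 : S3 (fun a b c => W b a * strong w a b c) = S.
  by rewrite S3C -W1; apply: eqS3 => a b c; rewrite strongC.
have W3 : S3 (fun a b c => W a c * strong w a b c) = S.
  by rewrite S3AC -W1; apply: eqS3 => a b c; rewrite strongAC.
have W4 : S3 (fun a b c => W c a * strong w a b c) = S.
  by rewrite S3AC -W2; apply: eqS3 => a b c; rewrite strongAC.
have W5 : S3 (fun a b c => W b c * strong w a b c) = S.
  by rewrite S3C -W3; apply: eqS3 => a b c; rewrite strongC.
have W6 : S3 (fun a b c => W c b * strong w a b c) = S.
  by rewrite S3C -W4; apply: eqS3 => a b c; rewrite strongC.
have -> : 18 * S = 3 * (S + S + S + S + S + S) by lia.
rewrite -{1}W1 -{1}W2 -{1}W3 -{1}W4 -{1}W5 -{1}W6 /S3.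
rewrite -!big_split !big_distrr /=; apply: leq_sum => a _.
rewrite -!big_split !big_distrr /=; apply: leq_sum => b _.
rewrite -!big_split !big_distrr /=; apply: leq_sum => c _.
have := @strong_changed w w' a b c mf.
by case: strong => [/(_ isT)|]; rewrite /W; lia.
Qed.

(** For fixed [u, v] the events for different [c] are independent, each of probability [8^-d]. *)
Lemma card_strong_family u v (C : {set V}) : u != v -> u \notin C -> v \notin C ->
  #|[set w : config V d | [forall c in C, strong w u v c]]| * 8 ^ (d * #|C|)
    = 2 ^ (#|V| * #|V| * d).
Proof.
move=> uv uC vC.
(* The bits [(u,c,i)], [(v,c,i)], [(c,v,i)] must differ from [(u,v,i)], [(v,u,i)], [(c,u,i)], which
   lie outside [J]. *)
pose A := setX [set u; v] C :|: setX C [set v].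
pose J := setX A [set: 'I_d].
pose p (t : V * V * 'I_d) := (t.1.1, if t.1.1 == u then v else u, t.2).
have pJ t : t \in J -> p t \notin J.
  case: t => [[x y] i]; rewrite !inE /= !andbT.
  case: (eqVneq x u) => [->|xu] /=; first by rewrite (negPf uC) (negPf vC).
  by rewrite (negPf uC) (negPf uv) !andbF.
have cJ : #|J| = 3 * (d * #|C|).
  rewrite !cardsX cardsT card_ord cardsU !cardsX cards1 cards2 uv.
  rewrite (_ : _ :&: _ = set0) ?cards0; first by lia.
  apply/setP => [[x y]]; rewrite !inE.
  by case: (eqVneq y v) => [->|]; rewrite ?(negPf vC) ?andbF.
have := card_cube_differ pJ; rewrite cJ !card_prod card_ord expnM => <-.
congr (_ * _); apply: eq_card => w; rewrite !inE.
apply/forall_inP/forall_inP => [st [[x y] i]|h c cC].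
  rewrite !inE /= !andbT /p /= => /orP[/andP[/orP[]/eqP-> yC]|/andP[xC /eqP->]].
  - by have /forallP/(_ i)/and3P[+ _ _] := st y yC; rewrite eqxx eq_sym.
  - have /forallP/(_ i)/and3P[_ + _] := st y yC.
    by rewrite (eq_sym v) (negPf uv) eq_sym.
  - have /forallP/(_ i)/and3P[_ _] := st x xC.
    by case: (eqVneq x u) xC => [->|_ _]; rewrite ?(negPf uC) // eq_sym.
have cu : (c == u) = false by apply: contraTF cC => /eqP ->.
have vu : (v == u) = false by rewrite eq_sym (negPf uv).
apply/forallP => i; apply/and3P; split; rewrite eq_sym.
- by have := h (u, c, i); rewrite !inE /p /= !eqxx cC; apply.
- by have := h (v, c, i); rewrite !inE /p /= vu !eqxx cC orbT; apply.
- by have := h (c, v, i); rewrite !inE /p /= cu !eqxx cC orbT; apply.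
Qed.

Lemma strong_uniq w a b c : 0 < d -> strong w a b c -> uniq [:: a; b; c].
Proof. by move=> d0 /forallP/(_ (Ordinal d0)) /aligned_uniq. Qed.

Lemma card_strong u v c : uniq [:: u; v; c] ->
  #|[set w : config V d | strong w u v c]| * 8 ^ d = 2 ^ (#|V| * #|V| * d).
Proof.
rewrite /= !inE negb_or !andbT => /andP[/andP[uv uc] vc].
have := @card_strong_family u v [set c] uv; rewrite !inE => /(_ uc vc) <-.
rewrite cards1 muln1; congr (_ * _); apply: eq_card => w; rewrite !inE.
apply/idP/forall_inP => [st c'|]; first by rewrite inE => /eqP ->.
by apply; rewrite inE.
Qed.

Lemma card_strong2 u v c c' : uniq [:: u; v; c] -> uniq [:: u; v; c'] -> c != c' ->
  #|[set w : config V d | strong w u v c && strong w u v c']| * (8 ^ d * 8 ^ d)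
    = 2 ^ (#|V| * #|V| * d).
Proof.
rewrite /= !inE !negb_or !andbT => /andP[/andP[uv uc] vc] /andP[/andP[_ uc'] vc'] cc'.
have := @card_strong_family u v [set c; c'] uv; rewrite !inE !negb_or.
rewrite uc uc' vc vc' => /(_ isT isT) <-.
rewrite cards2 cc' mulnC -expnD addnn -muln2 mulnC; congr (_ * _).
apply: eq_card => w; rewrite !inE.
apply/andP/forall_inP => [[st st'] c''|h].
  by rewrite !inE => /orP[]/eqP ->.
by rewrite !h // !inE eqxx ?orbT.
Qed.

End Codegree.

Lemma card_ordered_triples (V : finType) :
  \sum_(u : V) \sum_(v : V) \sum_(c : V) uniq [:: u; v; c]
    = #|V| * (#|V|.-1 * #|V|.-2).
Proof.
rewrite -sum_nat_const; apply: eq_bigr => u _.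
rewrite (bigID (predC1 u)) /= [X in _ + X]big1 ?addn0 => [|v]; last first.
  rewrite negbK => /eqP ->; apply: big1 => c _; by rewrite !inE eqxx.
transitivity (\sum_(v in predC1 u) #|V|.-2); last first.
  by rewrite sum_nat_const cardC1.
apply: eq_bigr => v vu.
rewrite (_ : _.-2 = #|~: [set u; v]|); last first.
  by rewrite cardsCs setCK cards2 eq_sym vu; lia.
rewrite -sum1_card [RHS]big_mkcond; apply: eq_bigr => c _.
rewrite /= !inE !negb_or !andbT (eq_sym u v) (eq_sym u c) (eq_sym v c) vu.
by case: (c == u); case: (c == v).
Qed.

Local Open Scope ring_scope.

(** * First and second moments of the codegrees *)

Section Moments.
Variables (R : realFieldType) (V : finType) (d : nat).
Hypothesis d_gt0 : (0 < d)%N.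
(** [N] counts the configurations and [q] is the probability that three given distinct vertices form
    a strong triple; sums over [w] are [N] times expectations. *)
Let n : R := #|V|%:R.
Let q : R := (8 ^+ d)^-1.
Let N : R := 2 ^+ (#|V| * #|V| * d).

Let q_gt0 : 0 < q.
Proof. by rewrite invr_gt0 exprn_gt0. Qed.

Let N_gt0 : 0 < N.
Proof. by rewrite exprn_gt0. Qed.

Let sum_cst (x : R) : \sum_(u : V) x = n * x.
Proof. by rewrite sumr_const -mulr_natl. Qed.

Lemma sum_strong u v c : uniq [:: u; v; c] ->
  \sum_(w : config V d) (strong w u v c)%:R = N * q :> R.
Proof.
move=> uvc; rewrite -natr_sum -big_mkcond /= sum1_card -cardsE.
have /(congr1 (fun m : nat => m%:R : R)) := card_strong d uvc.
rewrite natrM !natrX => h; rewrite /N -h mulfK //.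
by rewrite expf_neq0 // pnatr_eq0.
Qed.

Lemma sum_strong_le u v c : \sum_(w : config V d) (strong w u v c)%:R <= N * q.
Proof.
have [uvc|nuvc] := boolP (uniq [:: u; v; c]); first by rewrite sum_strong.
rewrite big1 ?mulr_ge0 ?ltW // => w _.
by case: (boolP (strong w u v c)) => // /(strong_uniq d_gt0); rewrite (negPf nuvc).
Qed.

Lemma sum_strong2_le u v c c' : c != c' ->
  \sum_(w : config V d) ((strong w u v c)%:R * (strong w u v c')%:R) <= N * q ^+ 2.
Proof.
move=> cc'.
have [/andP[uvc uvc']|nuvc] := boolP (uniq [:: u; v; c] && uniq [:: u; v; c']); last first.
  rewrite big1 ?mulr_ge0 ?exprn_ge0 ?ltW // => w _.
  case: (boolP (strong w u v c)) => [/(strong_uniq d_gt0) s|]; rewrite ?mul0r //.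
  case: (boolP (strong w u v c')) => [/(strong_uniq d_gt0) s'|]; rewrite ?mulr0 //.
  by rewrite s s' in nuvc.
under eq_bigr do rewrite -natrM mulnb.
rewrite -natr_sum -big_mkcond /= sum1_card -cardsE.
have /(congr1 (fun m : nat => m%:R : R)) := card_strong2 d uvc uvc' cc'.
rewrite !natrM !natrX => h.
by rewrite /N -h -expr2 -mulrA -exprMn mulfV ?expf_neq0 ?pnatr_eq0 // expr1n mulr1.
Qed.

(** The diagonal pairs [c = c'] give [n q]; the other pairs, being independent, give at most
    [n^2 q^2]. *)
Lemma sum_codegree_sqr u v :
  \sum_(w : config V d) (codegree w u v)%:R ^+ 2 <= N * (n * q + n ^+ 2 * q ^+ 2).
Proof.
have -> : \sum_(w : config V d) (codegree w u v)%:R ^+ 2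
    = \sum_c \sum_c' \sum_(w : config V d) ((strong w u v c)%:R * (strong w u v c')%:R) :> R.
  under [RHS]eq_bigr do rewrite exchange_big.
  rewrite [RHS]exchange_big; apply: eq_bigr => w _.
  rewrite /codegree natr_sum expr2 big_distrl /=.
  by apply: eq_bigr => c _; rewrite big_distrr.
apply: (@le_trans _ _ (\sum_(c : V) (N * q + n * (N * q ^+ 2)))).
  apply: ler_sum => c _; rewrite (bigD1 c) //=; apply: lerD.
    apply: le_trans (sum_strong_le u v c); apply: ler_sum => w _.
    by case: strong; rewrite ?mulr1 ?mul0r.
  apply: (@le_trans _ _ (\sum_(c' | c' != c) (N * q ^+ 2))).
    by apply: ler_sum => c' cc'; apply: sum_strong2_le; rewrite eq_sym.
  rewrite sumr_const -mulr_natl; apply: ler_wpM2r.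
    by rewrite mulr_ge0 ?exprn_ge0 ?ltW.
  by rewrite /n ler_nat max_card.
rewrite sum_cst; lra.
Qed.

(** Large when there are many strong triples that do not concentrate on few pairs; the scale [q n]
    is that of a typical codegree. *)
Definition excess (w : config V d) : R :=
  \sum_u \sum_v (codegree w u v)%:R
    - (\sum_u \sum_v (codegree w u v)%:R ^+ 2) / (4 * q * n).

Hypotheses (V_ge12 : (12 <= #|V|)%N) (V_big : (8 ^ d <= #|V|)%N).

Let n_ge12 : 12 <= n.
Proof. by rewrite /n ler_nat. Qed.

Let n0 : 0 < n.
Proof. exact: lt_le_trans n_ge12. Qed.

Let qn_ge1 : 1 <= q * n.
Proof. by rewrite /q /n ler_pdivlMl ?exprn_gt0 // mulr1 -natrX ler_nat. Qed.

(** On average the first sum is at least [3/4 q n^3], and the subtracted term is at most [1/2 q n^3]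
    because [q n >= 1] lets the off-diagonal part dominate. *)
Lemma sum_excess : N * q * n ^+ 3 / 4 <= \sum_w excess w.
Proof.
rewrite /excess sumrB -mulr_suml.
have S1 : \sum_(w : config V d) \sum_u \sum_v (codegree w u v)%:R
    >= N * q * (n * ((n - 1) * (n - 2))).
  have -> : \sum_(w : config V d) \sum_u \sum_v (codegree w u v)%:R
      = \sum_u \sum_v \sum_c \sum_(w : config V d) (strong w u v c)%:R :> R.
    rewrite exchange_big; apply: eq_bigr => u _; rewrite exchange_big.
    apply: eq_bigr => v _; rewrite [RHS]exchange_big; apply: eq_bigr => w _.
    by rewrite natr_sum.
  have -> : n * ((n - 1) * (n - 2)) = (#|V| * (#|V|.-1 * #|V|.-2))%:R.
    by rewrite !natrM -(subn2 #|V|) -(subn1 #|V|) !natrB //; lia.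
  rewrite -card_ordered_triples !natr_sum mulr_sumr; apply: ler_sum => u _.
  rewrite natr_sum mulr_sumr; apply: ler_sum => v _.
  rewrite natr_sum mulr_sumr; apply: ler_sum => c _.
  case: (boolP (uniq [:: u; v; c])) => [uvc|_]; first by rewrite mulr1 sum_strong.
  by rewrite mulr0; apply: sumr_ge0 => w _; rewrite ler0n.
have S2 : \sum_(w : config V d) \sum_u \sum_v (codegree w u v)%:R ^+ 2
    <= n ^+ 2 * (N * (n * q + n ^+ 2 * q ^+ 2)).
  rewrite exchange_big /=.
  apply: (@le_trans _ _ (\sum_(u : V) \sum_(v : V) (N * (n * q + n ^+ 2 * q ^+ 2)))).
    apply: ler_sum => u _; rewrite exchange_big /=; apply: ler_sum => v _.
    exact: sum_codegree_sqr.
  rewrite !sum_cst; lra.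
set S2' := (X in _ - X).
have S2'le : S2' <= N * q * n ^+ 3 / 2.
  rewrite /S2' ler_pdivrMr ?mulr_gt0 //; apply: le_trans S2 _.
  have h : n * q <= n ^+ 2 * q ^+ 2.
    rewrite -exprMn expr2; apply: ler_peMl; last by rewrite mulrC.
    by rewrite mulr_ge0 ?ltW.
  have -> : N * q * n ^+ 3 / 2 * (4 * q * n)
      = n ^+ 2 * (N * (n ^+ 2 * q ^+ 2 + n ^+ 2 * q ^+ 2)) by lra.
  apply: ler_wpM2l; first by rewrite exprn_ge0 ?ltW.
  by apply: ler_wpM2l; [rewrite ltW | rewrite lerD2r].
have Nq : 0 < N * q by rewrite mulr_gt0.
have quad (m : R) : 12 <= m -> m ^+ 2 * (3 / 4) <= (m - 1) * (m - 2).
  move=> m12; have : 0 <= (m - 12) * m by apply: mulr_ge0; lra.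
  by lra.
have : N * q * (n ^+ 3 * (3 / 4)) <= N * q * (n * ((n - 1) * (n - 2))).
  apply: ler_wpM2l; first exact: ltW.
  by rewrite exprS -mulrA; apply: ler_wpM2l; [exact: ltW | exact: quad].
lra.
Qed.

Lemma excess_le w : excess w <= n ^+ 3.
Proof.
apply: (@le_trans _ _ (\sum_(u : V) \sum_(v : V) (codegree w u v)%:R)).
  rewrite lerBlDr lerDl; apply: divr_ge0; last by rewrite !mulr_ge0 ?ltW.
  by apply: sumr_ge0 => u _; apply: sumr_ge0 => v _; rewrite exprn_ge0.
apply: (@le_trans _ _ (\sum_(u : V) \sum_(v : V) n)).
  apply: ler_sum => u _; apply: ler_sum => v _; rewrite /n ler_nat /codegree.
  by rewrite -big_mkcond sum1_card max_card.
by rewrite !sum_cst !exprS expr0 mulr1.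
Qed.

Definition rich : {set config V d} := [set w | q * n ^+ 3 / 8 <= excess w].

(** Reverse Markov: the mean of [excess] is at least [q n^3 / 4] and its maximum at most [n^3], so a
    proportion [q / 8] reaches half that mean. *)
Lemma card_rich : N * q / 8 <= #|rich|%:R.
Proof.
have n30 : 0 < n ^+ 3 by apply: exprn_gt0.
have : \sum_w excess w <= #|rich|%:R * n ^+ 3 + N * (q * n ^+ 3 / 8).
  have -> : N * (q * n ^+ 3 / 8) = \sum_(w : config V d) (q * n ^+ 3 / 8).
    by rewrite sumr_const -[RHS]mulr_natl card_ffun card_bool !card_prod card_ord natrX.
  have -> : #|rich|%:R * n ^+ 3 = \sum_w ((w \in rich)%:R * n ^+ 3).
    by rewrite -mulr_suml -natr_sum -big_mkcond sum1_card.
  rewrite -big_split /=.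
  apply: ler_sum => w _; rewrite inE; case: (lerP _ (excess w)) => h /=.
    by have := excess_le w; have : 0 < q * n ^+ 3 by [apply: mulr_gt0]; lra.
  by rewrite mul0r add0r ltW.
have := sum_excess => s1 s2.
rewrite -(ler_pM2r n30); lra.
Qed.

Lemma rich_far w w' : w \in rich -> majority_free w' ->
  (d * (#|V| * #|V|) <= 2592 * #|[set t | w t != w' t]|)%N.
Proof.
rewrite inE => wr mf.
(* With this cutoff [18 / (4 tau)] is the coefficient [1 / (4 q n)] of [excess]; finally
   [2592 = 8 * 18^2]. *)
pose tau := 18 * q * n.
have tau0 : 0 < tau by rewrite !mulr_gt0.
(* Codegrees above [tau] are charged to the second moment, through [(k - 2 tau)^2 >= 0]. *)
have wk (x k : R) : 0 <= x -> x <= d%:R -> x * k <= tau * x + d%:R * (k ^+ 2 / (4 * tau)).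
  move=> x0 xd.
  have k1 : k - tau <= k ^+ 2 / (4 * tau).
    rewrite ler_pdivlMr ?mulr_gt0 //; have := sqr_ge0 (k - 2 * tau); lra.
  have k2 : 0 <= k ^+ 2 / (4 * tau).
    by rewrite divr_ge0 ?sqr_ge0 // ltW // mulr_gt0.
  have := ler_wpM2l x0 k1; have := ler_wpM2r k2 xd; lra.
have natr_sum2 (F : V -> V -> nat) :
    (\sum_u \sum_v F u v)%:R = \sum_u \sum_v (F u v)%:R :> R.
  by rewrite natr_sum; apply: eq_bigr => u _; rewrite natr_sum.
have h1 := codegree_changed w mf; rewrite -(ler_nat R) !natrM !natr_sum2 in h1.
have h2 : \sum_u \sum_v (changed w w' u v * codegree w u v)%:R
   <= tau * #|[set t | w t != w' t]|%:R
     + d%:R * ((\sum_u \sum_v (codegree w u v)%:R ^+ 2) / (4 * tau)).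
  rewrite distance_changed natr_sum2 mulr_sumr mulr_suml mulr_sumr -big_split /=.
  apply: ler_sum => u _; rewrite mulr_sumr mulr_suml mulr_sumr -big_split /=.
  by apply: ler_sum => v _; rewrite natrM wk // ler_nat changed_le.
set D := (#|[set t | _]|) in h2 *.
rewrite -(ler_nat R) !natrM -/n.
pose Y : R := \sum_u \sum_v (codegree w u v)%:R ^+ 2.
have e1 : 18 * (d%:R * (Y / (4 * tau))) = d%:R * (Y / (4 * q * n)).
  by rewrite /tau; field; rewrite gt_eqF //= gt_eqF.
have d0 : 0 <= d%:R :> R by [].
have h3 := ler_wpM2l d0 wr.
have comb (e A X' W P Q t D' : R) : e * X' <= 18 * W -> W <= t * D' + e * P ->
    18 * (e * P) = e * Q -> e * A <= e * (X' - Q) -> e * A <= 18 * t * D' by lra.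
have h4 := comb _ _ _ _ _ _ _ _ h1 h2 e1 h3.
have qn0 : 0 < q * n by rewrite mulr_gt0.
rewrite -(ler_pM2l qn0).
have -> : q * n * (d%:R * (n * n)) = 8 * (d%:R * (q * n ^+ 3 / 8)) by lra.
by move: h4; rewrite /tau; lra.
Qed.

End Moments.

(** * Blow-up in the cube and the rarity of majority-free configurations *)

Lemma expr1D_le_inv (R : realFieldType) (t : R) k : 0 <= t ->
  (1 + t) ^+ k * (1 - k%:R * t) <= 1.
Proof.
move=> t0; elim: k => [|k IH]; first by rewrite mul0r subr0 mulr1.
apply: le_trans IH; rewrite exprS -mulrA mulrCA.
apply: ler_wpM2l; first by rewrite exprn_ge0 // addr_ge0.
rewrite -natr1; have : 0 <= (k%:R + 1) * (t * t) by rewrite !mulr_ge0 // addr_ge0.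
by lra.
Qed.

(* With [kappa = 1 + 1/m^2], [K - 1] is about [1/m], so [K + 1/K - 2] is about
   [1/m^2], which is less than [4 (kappa - 1)]. *)
Lemma blowup_gain (R : realFieldType) (m : nat) : (3 <= m)%N ->
  exists2 kappa : R, 1 < kappa & 2 + kappa ^+ m + kappa ^- m < 4 * kappa.
Proof.
move=> m3; have m3R : 3 <= m%:R :> R by rewrite ler_nat.
have m0 : 0 < m%:R :> R by lra.
pose t : R := (m%:R ^+ 2)^-1.
have t0 : 0 < t by rewrite invr_gt0 exprn_gt0.
exists (1 + t); first by rewrite ltrDl.
set K := (1 + t) ^+ m.
have K1 : 1 <= K by rewrite exprn_ege1 // lerDl ltW.
have mt : m%:R * t = m%:R^-1 by rewrite /t expr2 invfM mulrA mulfV ?mul1r ?gt_eqF.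
(* This gives [K (1 - 1/m) <= 1], hence [K - 1 <= 1/(m - 1)]. *)
have := expr1D_le_inv m (ltW t0); rewrite mt -/K => KU.
have Km : K * (m%:R - 1) <= m%:R.
  have -> : K * (m%:R - 1) = m%:R * (K * (1 - m%:R^-1)) by field; rewrite gt_eqF.
  by rewrite ger_pMr.
have K0 : 0 < K by lra.
have s : (K - 1) ^+ 2 * (m%:R - 1) ^+ 2 <= 1.
  rewrite -exprMn; apply: exprn_ile1; first by rewrite mulr_ge0; lra.
  lra.
have s2 : (K - 1) ^+ 2 < 4 * t.
  rewrite /t ltr_pdivlMr ?exprn_gt0 //.
  have h : m%:R ^+ 2 < 4 * (m%:R - 1) ^+ 2 :> R.
    have : 0 <= (m%:R - 3) * (m%:R - 3) :> R by rewrite -expr2 sqr_ge0.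
    by nra.
  have [->|Kn1] := eqVneq K 1; first by rewrite subrr expr0n mul0r.
  have sq : 0 < (K - 1) ^+ 2 by rewrite lt_neqAle sqr_ge0 eq_sym sqrf_eq0 subr_eq0 Kn1.
  have := ltr_pM2l sq (m%:R ^+ 2) (4 * (m%:R - 1) ^+ 2); rewrite h => h'.
  lra.
have -> : 2 + K + K^-1 = 4 + (K - 1) ^+ 2 / K by field; rewrite gt_eqF.
have : (K - 1) ^+ 2 / K <= (K - 1) ^+ 2.
  by rewrite ler_pdivrMr // ler_peMr // sqr_ge0.
lra.
Qed.

(** Rich and majority-free configurations are at distance at least [D / 2592], so [K = kappa^2592]
    separates them with [M = kappa^D]. Dividing by the size of [rich] leaves a [beta] independent of
    [V] and [d]. *)
Lemma majority_free_rare (R : realFieldType) : exists2 beta : R, 0 < beta < 1 &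
  forall (V : finType) d, (0 < d)%N -> (12 <= #|V|)%N -> (8 ^ d <= #|V|)%N ->
    #|[set w : config V d | majority_free w]|%:R
      <= 8 ^+ d.+1 * beta ^+ (#|V| * #|V| * d) * 2 ^+ (#|V| * #|V| * d).
Proof.
have [kappa k1 gain] := @blowup_gain R 2592 isT.
have k0 : 0 < kappa by lra.
set K := kappa ^+ 2592 in gain.
have K1 : 1 <= K by rewrite exprn_ege1 // ltW.
have Ki : 0 < K^-1 by rewrite invr_gt0; lra.
exists ((2 + K + K^-1) / (4 * kappa)).
  apply/andP; split; first by rewrite divr_gt0 ?mulr_gt0 //; lra.
  by rewrite ltr_pdivrMr ?mul1r ?mulr_gt0.
move=> V d d0 V12 Vbig; set D := (#|V| * #|V| * d)%N.
set I := [set w | _].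
have sep : forall w w', w \in rich R V d -> w' \in I ->
    kappa ^+ D <= K ^+ #|[set t | w t != w' t]|.
  move=> w w' wr; rewrite inE => mf.
  rewrite /K -exprM; apply: ler_weXn2l; first exact: ltW.
  by have := rich_far V12 wr mf; rewrite /D mulnC.
have := cube_separated_sets K1 (exprn_ge0 D (ltW k0)) sep.
rewrite !card_prod card_ord -/D => h.
have rich_ge := card_rich R d0 V12 Vbig; rewrite -/D in rich_ge.
have kD : 0 < kappa ^+ D by rewrite exprn_gt0.
have q0 : 0 < 8 ^+ d :> R by rewrite exprn_gt0.
have D2 : 0 < 2 ^+ D :> R by rewrite exprn_gt0.
have h' : kappa ^+ D * (2 ^+ D * 8 ^- d / 8 * #|I|%:R) <= (2 + K + K^-1) ^+ D.
  apply: le_trans h; apply: ler_wpM2l; first exact: ltW.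
  by apply: ler_wpM2r.
have e : (2 + K + K^-1) ^+ D
    = kappa ^+ D * (2 ^+ D * 8 ^- d / 8 *
       (8 ^+ d.+1 * ((2 + K + K^-1) / (4 * kappa)) ^+ D * 2 ^+ D)).
  rewrite exprS exprMn exprVn exprMn -[4]/(2 * 2)%:R natrM exprMn.
  by field; rewrite !gt_eqF // exprn_gt0.
rewrite e ler_pM2l // ler_pM2l // in h'.
by rewrite !divr_gt0.
Qed.

(** Union bound: otherwise every [w] is majority-free along some injection of ['I_n]. *)
Lemma exists_link_triangle_free_sparse n N d :
    (N ^ n * #|[set w : config 'I_n d | majority_free w]| < 2 ^ (n * n * d))%N ->
  exists G : three_graph 'I_N, link_triangle_free G /\
    forall S, independent3 G S -> #|S| <> n.
Proof.
move=> few; apply: contrapT => none.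
have all_g (w : config 'I_N d) : exists2 g : {ffun 'I_n -> 'I_N},
    injectiveb g & majority_free (pull_config g w).
  apply: contrapT => no_g; apply: none; exists (alignment_graph w); split.
    exact: alignment_graph_free.
  move=> S indS Sn; apply: no_g.
  pose g := [ffun i : 'I_n => enum_val (cast_ord (esym Sn) i)].
  have gI : injective g by move=> i j; rewrite !ffunE => /enum_val_inj /cast_ord_inj.
  exists g; first exact/injectiveP.
  apply: majority_free_pull => //.
  suff -> : g @: setT = S by [].
  apply/eqP; rewrite eqEcard card_imset // cardsT card_ord Sn leqnn andbT.
  by apply/subsetP => _ /imsetP[i _ ->]; rewrite ffunE enum_valP.
have cover : [set: config 'I_N d] \subset
    \bigcup_(g : {ffun 'I_n -> 'I_N} | injectiveb g)
      [set w : config 'I_N d | majority_free (pull_config g w)].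
  apply/subsetP => w _; have [g gI mf] := all_g w.
  by apply/bigcupP; exists g => //; rewrite inE.
move: few; rewrite ltnNge => /negP; apply.
have pos : (0 < 2 ^ (N * N * d))%N by rewrite expn_gt0.
rewrite -(leq_pmul2l pos).
have {1}-> : (2 ^ (N * N * d) = #|[set: config 'I_N d]|)%N.
  by rewrite cardsT card_ffun card_bool !card_prod !card_ord.
apply: (@leq_trans (\sum_(g : {ffun 'I_n -> 'I_N} | injectiveb g)
    #|[set w : config 'I_N d | majority_free (pull_config g w)]| * 2 ^ (n * n * d))).
  rewrite -big_distrl leq_mul2r; apply/orP; right.
  apply: leq_trans (subset_leq_card cover) _.
  elim/big_rec2: _ => [|g B m _ Bm]; first by rewrite cards0.
  by apply: leq_trans (leq_card_setU _ _).1 _; rewrite leq_add2l.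
(* Every injection contributes the same proportion; summing over all [N^n] maps only increases the
   total. *)
apply: (@leq_trans (\sum_(g : {ffun 'I_n -> 'I_N})
    #|[set w : config 'I_n d | majority_free w]| * 2 ^ (N * N * d))).
  rewrite [leqRHS](bigID (fun g : {ffun 'I_n -> 'I_N} => injectiveb g)) /=.
  apply: leq_trans (leq_addr _ _); apply: leq_sum => g /injectiveP gI.
  pose h (t : 'I_n * 'I_n * 'I_d) := (g t.1.1, g t.1.2, t.2).
  have hI : injective h by move=> [[x y] i] [[x' y'] i'] [/gI -> /gI -> ->].
  have := card_cube_pullback (@majority_free _ d) hI.
  by rewrite !card_prod !card_ord => <-.
by rewrite sum_nat_const card_ffun !card_ord; lia.
Qed.

(** * Asymptotics *)

Lemma powRE_gt0 (R : realType) (a x : R) : 0 < a -> a `^ x = expR (x * ln a).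
Proof. by move=> a0; rewrite /powR gt_eqF. Qed.

Lemma expRX_ln (R : realType) (a : R) n : 0 < a -> a ^+ n = expR (n%:R * ln a).
Proof. by move=> a0; rewrite expRM_natl lnK. Qed.

Lemma sparse_three_graphs (R : realType) : exists2 c : R, 0 < c &
  exists n0 : nat, forall n N, (n0 <= n)%N -> N%:R <= n%:R `^ (c * n%:R) ->
    exists G : three_graph 'I_N, link_triangle_free G /\
      forall S, independent3 G S -> #|S| <> n.
Proof.
have [beta /andP[b0 b1] rare] := majority_free_rare R.
pose lam := - ln beta.
have lam0 : 0 < lam by rewrite oppr_gt0 ln_lt0 // b0.
pose l8 : R := ln 8.
have l80 : 0 < l8 by rewrite ln_gt0 // ltr1n.
(* As [ln n <= 2 d l8], this [c] gives [n ln N <= lam n^2 d / 2], half of the exponent gained from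
   [beta^D]. *)
exists (lam / (4 * l8)); first by rewrite divr_gt0 // mulr_gt0.
(* For [n > 4 l8 / lam] the factor [8^(d+1)] uses less than the other half. *)
exists (maxn 12 (Num.trunc (4 * l8 / lam)).+1) => n N.
rewrite geq_max => /andP[n12 nbig] NU.
have n0 : 0 < n%:R :> R by rewrite ltr0n; lia.
have n1 : 1 <= n%:R :> R by rewrite ler1n; lia.
pose d := trunc_log 8 n.
have d8 : (8 ^ d <= n)%N by apply: trunc_logP; lia.
have n8 : (n < 8 ^ d.+1)%N by apply: trunc_log_ltn.
have d0 : (0 < d)%N by case: d n8 {d8} => // ; rewrite expn1; lia.
apply: (@exists_link_triangle_free_sparse n N d).
have [->|N0] := posnP N; first by rewrite exp0n ?expn_gt0 //; lia.
have d1 : 1 <= d%:R :> R by rewrite ler1n.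
have := rare 'I_n d d0; rewrite card_ord => /(_ n12 d8).
set I := #|_|; set D := (n * n * d)%N => IU.
rewrite -(ltr_nat R) natrM !natrX.
have D2 : 0 < 2 ^+ D :> R by rewrite exprn_gt0.
suff lt1 : N%:R ^+ n * (8 ^+ d.+1 * beta ^+ D) < 1.
  have NX : 0 <= N%:R ^+ n :> R by rewrite exprn_ge0.
  apply: le_lt_trans (ler_wpM2l NX IU) _.
  by rewrite mulrA gtr_pMl.
have N0R : 0 < N%:R :> R by rewrite ltr0n.
rewrite !expRX_ln // -!expRD -[ltRHS]expR0 ltr_expR -/l8.
have lnN : ln N%:R <= lam / (4 * l8) * n%:R * ln n%:R.
  by move: NU; rewrite powRE_gt0 // -{1}(lnK (_ : N%:R \in Num.pos)) ?posrE // ler_expR.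
have lnn : ln n%:R <= 2 * d%:R * l8.
  have : ln n%:R <= ln (8 ^+ d.+1 : R).
    by rewrite ler_ln ?posrE ?exprn_gt0 // -natrX ler_nat ltnW.
  rewrite lnXn // -/l8 -(mulr_natl l8) -natr1 => h; apply: le_trans h _.
  by apply: ler_wpM2r; [exact: ltW | lra].
have lnN2 : n%:R * ln N%:R <= lam / 2 * (n%:R * n%:R * d%:R).
  apply: (@le_trans _ _ (n%:R * (lam / (4 * l8) * n%:R * (2 * d%:R * l8)))).
    apply: ler_wpM2l; first exact: ltW.
    apply: le_trans lnN _; apply: ler_wpM2l => //.
    by rewrite mulr_ge0 ?divr_ge0 ?mulr_ge0 ?ltW.
  by rewrite le_eqVlt; apply/orP; left; apply/eqP; field; rewrite gt_eqF.
have nbigR : 4 * l8 < lam * n%:R.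
  rewrite -ltr_pdivrMl // mulrC; apply: lt_le_trans (truncnS_gt _) _.
  by rewrite ler_nat.
have small : d.+1%:R * l8 < lam / 2 * (n%:R * n%:R * d%:R).
  have h1 : d.+1%:R * l8 <= d%:R * (2 * l8).
    by rewrite -natr1 mulrA; apply: ler_wpM2r; [exact: ltW | lra].
  apply: le_lt_trans h1 _.
  have -> : lam / 2 * (n%:R * n%:R * d%:R) = d%:R * (lam / 2 * (n%:R * n%:R)) by ring.
  rewrite ltr_pM2l; last by lra.
  have nn : n%:R <= n%:R * n%:R :> R by apply: ler_peMl => //; exact: ltW.
  have := ler_wpM2l (ltW lam0) nn; lra.
have -> : D%:R * ln beta = - (lam * (n%:R * n%:R * d%:R)).
  by rewrite /D !natrM /lam; ring.
lra.
Qed.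

Lemma ln_le_half (R : realType) (z : R) : 0 < z -> ln z <= z / 2.
Proof.
move=> z0.
have -> : ln z = ln (z / 2) + ln 2.
  by rewrite ln_div ?posrE // subrK.
have h1 := @le_ln1Dx R (z / 2 - 1).
have h2 := @le_ln1Dx R 1.
rewrite addrCA subrr addr0 in h1.
have {}h1 := h1 ltac:(lra).
have {}h2 := h2 ltac:(lra).
lra.
Qed.

(** With [y = ln x], [expR (y / 2) >= y / 2] gives [x >= y^2 / 4]. *)
Lemma div_ln_ge (R : realType) (x : R) : 1 < x -> ln x / 4 <= x / ln x.
Proof.
move=> x1; have y0 := ln_gt0 x1.
rewrite ler_pdivlMr // -[leRHS]lnK ?posrE; last lra.
have -> : ln x = ln x / 2 + ln x / 2 by lra.
rewrite expRD; set y := ln x in y0 *.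
have h := @expR_ge1Dx R (y / 2).
have h' : y / 2 * (y / 2) <= expR (y / 2) * expR (y / 2) by apply: ler_pM; lra.
by lra.
Qed.

Lemma expnM4_le n : (4 <= n)%N -> ((4 * n) ^ (n + n) <= n ^ (4 * n))%N.
Proof.
move=> n4; have -> : (4 * n = 2 * (n + n))%N by lia.
rewrite [leqRHS]expnM leq_exp2r; last by lia.
by nia.
Qed.

Theorem theorem1p1 (R : realType) :
  (exists c C : R, 0 < c /\ 0 < C /\
    exists n0 : nat, forall n : nat, (n0 <= n)%N ->
      exists r : nat, is_ramsey_number K4_minus_e (K3 n) r /\
        n%:R `^ (c * n%:R) <= r%:R /\ r%:R <= n%:R `^ (C * n%:R))
  /\
  (exists c C : R, 0 < c /\ 0 < C /\
    exists N0 : nat, forall N : nat, (N0 <= N)%N ->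
      c * (ln N%:R / ln (ln N%:R)) <= (min_independence_number N)%:R /\
      (min_independence_number N)%:R <= C * (ln N%:R / ln (ln N%:R))).
Proof.
have [c c0 [n0 sparse]] := sparse_three_graphs R.
split.
  exists c, 4; split=> //; split=> //; exists (maxn n0 4) => n.
  rewrite geq_max => /andP[nn0 n4].
  have ramU : ramsey_property K4_minus_e (K3 n) ((4 * n) ^ (n + n))%N.
    apply/ramsey_propertyP => G free.
    by apply: independent_of_large_link_triangle_free; rewrite ?card_ord.
  have ex_ram : exists r, `[< ramsey_property K4_minus_e (K3 n) r >].
    by exists ((4 * n) ^ (n + n))%N; apply/asboolP.
  case: (ex_minnP ex_ram) => r /asboolP ram_r min_r; exists r; split.
    by split=> // N ramN; apply: min_r; apply/asboolP.
  split; last first.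
    rewrite -natrM powR_mulrn // -natrX ler_nat.
    by apply: leq_trans (expnM4_le n4); apply: min_r; apply/asboolP.
  (* Were [r] below the bound, the sparse 3-graph on [r] vertices would contradict [ram_r]. *)
  rewrite leNgt; apply/negP => /ltW /(sparse n r nn0)[G [free noS]].
  have /ramsey_propertyP/(_ G free)[S indS Sn] := ram_r.
  exact: noS indS Sn.
(* Chosen so that [c * (C x / y) * (y / 2) = x + c x / 2 >= x], while [C >= 1]. *)
pose C : R := 1 + 2 / c.
have C1 : 1 <= C by rewrite lerDl divr_ge0 // ltW.
exists 4^-1, C; split; first by rewrite invr_gt0.
split; first by lra.
(* Since [x / y >= y / 4], having [y >= Y] ensures [x / y >= 4 + n0]. *)
pose Y : R := 16 + 4 * n0%:R.
exists (Num.trunc (expR (expR Y))).+1 => N NN0.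
set x : R := ln N%:R; set y := ln x.
have Nbig : expR (expR Y) <= N%:R.
  by apply: ltW; apply: lt_le_trans (truncnS_gt _) _; rewrite ler_nat.
have Y16 : 16 <= Y by rewrite /Y lerDl mulr_ge0.
have N0 : 0 < N%:R :> R by apply: lt_le_trans Nbig; apply: expR_gt0.
have xbig : expR Y <= x by rewrite -(expRK (expR Y)) ler_ln ?posrE ?expR_gt0.
have x0 : 0 < x by apply: lt_le_trans xbig; apply: expR_gt0.
have ybig : Y <= y by rewrite -(expRK Y) ler_ln ?posrE ?expR_gt0.
have y16 : 16 <= y by lra.
have y0 : 0 < y by lra.
have x1 : 1 < x by have := @expR_ge1Dx R Y; lra.
have xy := div_ln_ge x1; rewrite -/y in xy.
have Nx : N%:R = expR x by rewrite lnK ?posrE.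
split.
  (* Then [4 n <= x], so [2 n ln (4 n) <= 2 n y <= x = ln N]; rounding is harmless as
     [x / y >= 4]. *)
  pose n := Num.trunc (x / (2 * y)).
  have xy0 : 0 <= x / (2 * y) by rewrite divr_ge0 ?mulr_ge0 ?ltW.
  have /andP[nle nlt] := truncn_itv xy0; rewrite -/n -natr1 in nle nlt.
  have e : x / (2 * y) = x / y / 2 by field; rewrite gt_eqF.
  rewrite e in nle nlt.
  have n1 : 1 <= n%:R :> R by lra.
  have [G free ->] := min_independence_numberP N.
  have [|S indS Sn] := @independent_of_large_link_triangle_free _ G n free.
    rewrite card_ord -(ler_nat R) natrX expRX_ln ?Nx; last by rewrite natrM; lra.
    rewrite ler_expR natrD natrM.
    have n4 : ln (4 * n%:R) <= y.
      rewrite /y ler_ln ?posrE //; last by lra.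
      have : x / y <= x / 2.
        by apply: ler_wpM2l; [exact: ltW | rewrite lef_pV2 ?posrE; lra].
      lra.
    have : n%:R * y <= x / y / 2 * y by apply: ler_wpM2r; lra.
    have -> : x / y / 2 * y = x / 2 by field; rewrite gt_eqF.
    have : n%:R * ln (4 * n%:R) <= n%:R * y by apply: ler_wpM2l; lra.
    lra.
  apply: (@le_trans _ _ n%:R); first by lra.
  by rewrite ler_nat -Sn independence_number_ge.
(* The successor pays for strictness: an independence number below [n] is at most [C x / y]. *)
pose n := (Num.trunc (C * (x / y))).+1.
have Cxy0 : 0 <= C * (x / y) by rewrite mulr_ge0 //; lra.
have /andP[nle nlt] := truncn_itv Cxy0; rewrite -/n in nlt.
have xyC : x / y <= C * (x / y) by rewrite ler_peMl //; lra.
have nn0 : (n0 <= n)%N.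
  by rewrite -(ler_nat R); move: ybig; rewrite /Y; lra.
have nR0 : 0 < n%:R :> R by rewrite ltr0n.
have [|G [free noS]] := sparse n N nn0.
  rewrite powRE_gt0 // Nx ler_expR.
  have lnn : y / 2 <= ln n%:R.
    have : ln (x / y) <= ln n%:R by rewrite ler_ln ?posrE ?divr_gt0 //; lra.
    rewrite ln_div ?posrE // -/y; have := ln_le_half y0; lra.
  apply: (@le_trans _ _ (c * (C * (x / y)) * (y / 2))).
    have -> : c * (C * (x / y)) * (y / 2) = c / 2 * x + x.
      by rewrite /C; field; rewrite !gt_eqF.
    by rewrite lerDr mulr_ge0 ?divr_ge0 ?ltW.
  apply: ler_pM => //; first by rewrite mulr_ge0 // ltW.
    by lra.
  by apply: ler_wpM2l; lra.
apply: le_trans nle; rewrite ler_nat -ltnS -/n.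
apply: leq_ltn_trans (min_independence_number_le free) _.
by apply: independence_number_lt.
Qed.
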